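(* Let $N\ge 1$ be an integer and $h=1/N$. For all $u,v\in D_{0,h}$, $$(\nabla_{x+}u,v)_h=-(u,\nabla_{x-}v)_h\qquad\text{and}\qquad(\nabla_{y+}u,v)_h=-(u,\nabla_{y-}v)_h.$$
   Context: Let $N\ge1$ be an integer and $h=1/N$. The grid is $\Omega_h=\{(ih,jh):0\le i,j\le N\}\subset[0,1]^2$. $D_h$ is the real vector space of functions $u:\Omega_h\to\mathbb{R}$, with the notation $u_{i,j}=u(ih,jh)$, and $D_{0,h}\subset D_h$ is the subspace of functions vanishing at all boundary grid points (those with $i\in\{0,N\}$ or $j\in\{0,N\}$). The discrete inner product is $(u,v)_h=h^2\sum_{p\in\Omega_h}u(p)v(p)$. The differences are $\nabla_{x+}u_{i,j}=(u_{i+1,j}-u_{i,j})/h$, $\nabla_{y+}u_{i,j}=(u_{i,j+1}-u_{i,j})/h$, $\nabla_{x-}u_{i,j}=(u_{i,j}-u_{i-1,j})/h$, $\nabla_{y-}u_{i,j}=(u_{i,j}-u_{i,j-1})/h$. For $u\in D_{0,h}$, $u$ is extended by zero outside the grid, so that these differences are defined on all of $\Omega_h$. *)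

(* Defs.v *)
From HB Require Import structures.
From mathcomp Require Import all_boot all_order all_algebra.
From mathcomp Require Import reals.
Set Implicit Arguments.
Unset Strict Implicit.
Unset Printing Implicit Defensive.
Import Order.TTheory GRing.Theory Num.Theory.
Local Open Scope ring_scope.

Definition mesh (R : realType) (N : nat) : R := N%:R^-1.

(* The index pair (i, j) stands for the grid point (i h, j h). *)
Definition grid (N : nat) : finType := ('I_N.+1 * 'I_N.+1)%type.

(* D_h: the value u (i, j) is u_{i,j} = u(i h, j h). *)
Notation Dh R N := {ffun grid N -> R}.

Definition boundary (N : nat) : pred (grid N) :=
  fun p => [|| p.1 == 0%N :> nat, p.1 == N :> nat,
               p.2 == 0%N :> nat | p.2 == N :> nat].

(* D_{0,h} *)
Definition D0h (R : realType) (N : nat) : {pred Dh R N} :=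
  fun u => [forall p : grid N, boundary p ==> (u p == 0)].

(* R^o is R as a module over itself, giving D_h its vector space structure. *)
Fact D0h_submod_closed (R : realType) (N : nat) :
  @submod_closed R {ffun grid N -> R^o} (@D0h R N).
Proof.
split=> [|a u v /forallP u0 /forallP v0].
  by apply/forallP=> p; apply/implyP=> _; rewrite ffunE.
apply/forallP=> p; apply/implyP=> bp; rewrite !ffunE.
by rewrite (eqP (implyP (u0 p) bp)) (eqP (implyP (v0 p) bp)) scaler0 addr0.
Qed.

Definition inner_h (R : realType) (N : nat) (u v : Dh R N) : R :=
  mesh R N ^+ 2 * \sum_(p : grid N) u p * v p.

(* Extension of u by zero to Z x Z; inord only acts on indices in 0..N. *)
Definition ext0 (R : realType) (N : nat) (u : Dh R N) (i j : int) : R :=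
  if (0 <= i <= N%:Z) && (0 <= j <= N%:Z)
  then u (inord `|i|%N, inord `|j|%N) else 0.

Fact ext0_grid (R : realType) (N : nat) (u : Dh R N) (p : grid N) :
  ext0 u p.1 p.2 = u p.
Proof.
by case: p => i j; rewrite /ext0 /= !lez_nat !leq_ord !inord_val.
Qed.

(* Through ext0 the four differences are total on D_h; they agree with the
   differences of the zero extension, hence are the intended ones on D_{0,h}. *)
Definition nablaxp (R : realType) (N : nat) (u : Dh R N) : Dh R N :=
  [ffun p : grid N =>
    (ext0 u (p.1%:Z + 1) p.2%:Z - ext0 u p.1%:Z p.2%:Z) / mesh R N].

Definition nablayp (R : realType) (N : nat) (u : Dh R N) : Dh R N :=
  [ffun p : grid N =>
    (ext0 u p.1%:Z (p.2%:Z + 1) - ext0 u p.1%:Z p.2%:Z) / mesh R N].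

Definition nablaxm (R : realType) (N : nat) (u : Dh R N) : Dh R N :=
  [ffun p : grid N =>
    (ext0 u p.1%:Z p.2%:Z - ext0 u (p.1%:Z - 1) p.2%:Z) / mesh R N].

Definition nablaym (R : realType) (N : nat) (u : Dh R N) : Dh R N :=
  [ffun p : grid N =>
    (ext0 u p.1%:Z p.2%:Z - ext0 u p.1%:Z (p.2%:Z - 1)) / mesh R N].

(* Main.v *)
Require Import Defs.
From HB Require Import structures.
From mathcomp Require Import all_boot all_order all_algebra.
From mathcomp Require Import reals ring.
Import Order.TTheory GRing.Theory Num.Theory.
Local Open Scope ring_scope.

(** Each identity is one-dimensional summation by parts ([sum_by_parts]) along every grid line in
    the direction of differencing, summed over the transverse index; [inner_h_sum2] supplies the
    iterated sums. Shifting the index costs only end terms, which vanish because the zero extension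
    is 0 at indices -1 and N + 1. *)

(** Taking [a] and [b] on [int] gives meaning to the values just outside the range; [c] is 1/h,
    placed where unfolding the differences leaves it. *)
Lemma sum_by_parts (R : comPzRingType) (n : nat) (c : R) (a b : int -> R) :
  a (n%:Z + 1) = 0 -> b (-1) = 0 ->
  \sum_(i < n.+1) (a (i%:Z + 1) - a i%:Z) * c * b i%:Z =
  - \sum_(i < n.+1) a i%:Z * ((b i%:Z - b (i%:Z - 1)) * c).
Proof.
move=> an b0; rewrite -sumrN.
have shift : \sum_(i < n.+1) a (i%:Z + 1) * b i%:Z =
             \sum_(i < n.+1) a i%:Z * b (i%:Z - 1).
  (* The left sum loses its last term and the right sum its first; the remaining [n] terms match
     after reindexing. *)
  rewrite big_ord_recr /= an mul0r addr0 [RHS]big_ord_recl /= sub0r b0 mulr0.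
  rewrite add0r; apply: eq_bigr => i _.
  by rewrite /bump /= add1n -addn1 PoszD addrK.
have -> : \sum_(i < n.+1) (a (i%:Z + 1) - a i%:Z) * c * b i%:Z =
    c * (\sum_(i < n.+1) a (i%:Z + 1) * b i%:Z
         - \sum_(i < n.+1) a i%:Z * b i%:Z).
  by rewrite -sumrB mulr_sumr; apply: eq_bigr => i _; ring.
by rewrite shift -sumrB mulr_sumr; apply: eq_bigr => i _; ring.
Qed.

Lemma ext0_out (R : realType) (N : nat) (u : Dh R N) (i j : int) :
  ~~ ((0 <= i <= N%:Z) && (0 <= j <= N%:Z)) -> ext0 u i j = 0.
Proof. by rewrite /ext0 => /negbTE ->. Qed.

Lemma inner_h_sum2 (R : realType) (N : nat) (u v : Dh R N) :
  inner_h u v = mesh R N ^+ 2 *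
    \sum_(i < N.+1) \sum_(j < N.+1) u (i, j) * v (i, j).
Proof.
by rewrite /inner_h pair_bigA; congr (_ * _); apply: eq_bigr => -[].
Qed.

Theorem lemma1 (R : realType) (N : nat) (hN : (1 <= N)%N)
    (u v : Dh R N) (hu : u \in @D0h R N) (hv : v \in @D0h R N) :
  inner_h (nablaxp u) v = - inner_h u (nablaxm v) /\
  inner_h (nablayp u) v = - inner_h u (nablaym v).
Proof.
have past : (N%:Z + 1 <= N%:Z) = false by rewrite lezD1 ltxx.
split; rewrite !inner_h_sum2 -mulrN -sumrN; congr (_ * _).
  (* For x-differences the sum over [i] must be the inner one; the sign is moved out and back so
     that the right-hand sums can be exchanged. *)
  rewrite exchange_big sumrN [in RHS]exchange_big -sumrN.
  apply: eq_bigr => j _ /=.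
  (* The undifferenced factors are also written through [ext0], so that each side involves only
     functions on [int]. *)
  under eq_bigr do rewrite ffunE -(ext0_grid v).
  under [in RHS]eq_bigr do rewrite ffunE -(ext0_grid u).
  by apply: (@sum_by_parts _ _ _ (ext0 u ^~ j%:Z) (ext0 v ^~ j%:Z));
    apply: ext0_out; rewrite ?past ?andbF.
apply: eq_bigr => i _.
under eq_bigr do rewrite ffunE -(ext0_grid v).
under [in RHS]eq_bigr do rewrite ffunE -(ext0_grid u).
by apply: (@sum_by_parts _ _ _ (ext0 u i%:Z) (ext0 v i%:Z));
  apply: ext0_out; rewrite ?past ?andbF.
Qed.
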